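(* Let $X$ and $Y$ be $C^\infty$ vector fields on $\mathbb{R}^2$ with $X(0)=Y(0)=0$, each globally asymptotically stable at the origin. Let $\mathcal{Z}=\{p\in\mathbb{R}^2 : \det(X(p),Y(p))=0\}$. If $\mathcal{Z}$ has an inverse component, then the switched system $$\dot q=u\,X(q)+(1-u)\,Y(q),\qquad q\in\mathbb{R}^2,\ u\in[0,1],$$ is not globally attractive at the origin.
   Context: The components of $\mathcal{Z}$ are, by convention, the connected components of $\mathcal{Z}\setminus\{0\}$. A component $\Gamma$ is called inverse if, for $p\in\Gamma$, the (nonzero, parallel) vectors $X(p)$ and $Y(p)$ have opposite direction; this does not depend on the choice of $p\in\Gamma$. Switching functions are arbitrary measurable functions $u:[0,\infty)\to[0,1]$; let $\mathcal{U}$ be the set of all of them. For $p\in\mathbb{R}^2$ and $u\in\mathcal{U}$, let $t\mapsto\gamma(p,u,t)$ be the maximal solution of $\dot q(t)=u(t)X(q(t))+(1-u(t))Y(q(t))$ with $\gamma(p,u,0)=p$. The system is globally attractive at the origin if, for every $u\in\mathcal{U}$ and every $p\in\mathbb{R}^2$, $\gamma(p,u,t)$ converges to the origin as $t\to+\infty$. A vector field is globally asymptotically stable at the origin if the origin is a Lyapunov stable equilibrium and all its integral curves converge to the origin as $t\to+\infty$. *)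

(* Defs.v *)
From mathcomp Require Import all_boot all_order all_algebra.
From mathcomp Require Import all_classical all_reals all_analysis.
Set Implicit Arguments.
Unset Strict Implicit.
Unset Printing Implicit Defensive.
Import Order.TTheory GRing.Theory Num.Theory.
Import numFieldNormedType.Exports.
Local Open Scope classical_set_scope.
Local Open Scope ring_scope.

(* Points of the plane are row vectors; the library's norm on ['rV[R]_2] is the
   sup norm, which induces the usual topology. *)
Definition vfield (R : realType) := 'rV[R]_2 -> 'rV[R]_2.

Fixpoint Ck (R : realType) (k : nat) (F : vfield R) : Prop :=
  if k is k'.+1 then
    forall i : 'I_2,
      (forall p, derivable F p (delta_mx 0 i)) /\ Ck k' ('D_(delta_mx 0 i) F)
  else continuous F.

(* Asking for all [k], [0] included, yields continuity of [F] and of all its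
   iterated partial derivatives. *)
Definition smooth (R : realType) (F : vfield R) : Prop := forall k, Ck k F.

(* The set of times is the open interval ]a, b[, which contains 0; the values
   of [q] outside it are irrelevant. *)
Definition integral_curve (R : realType) (F : vfield R) (p : 'rV[R]_2)
    (a b : \bar R) (q : R -> 'rV[R]_2) : Prop :=
  [/\ (a < 0%:E)%E, (0%:E < b)%E, q 0 = p &
      forall t : R, (a < t%:E)%E -> (t%:E < b)%E -> is_derive t 1 q (F (q t))].

Definition maximal_integral_curve (R : realType) (F : vfield R) (p : 'rV[R]_2)
    (a b : \bar R) (q : R -> 'rV[R]_2) : Prop :=
  integral_curve F p a b q /\
  forall (a' b' : \bar R) (q' : R -> 'rV[R]_2),
    integral_curve F p a' b' q' -> (a' <= a)%E -> (b <= b')%E ->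
    (forall t : R, (a < t%:E)%E -> (t%:E < b)%E -> q' t = q t) ->
    a' = a /\ b' = b.

Definition lyapunov_stable (R : realType) (F : vfield R) : Prop :=
  F 0 = 0 /\
  forall e : R, 0 < e -> exists2 d : R, 0 < d &
    forall (p : 'rV[R]_2) (a b : \bar R) (q : R -> 'rV[R]_2),
      `|p| < d -> integral_curve F p a b q ->
      forall t : R, 0 <= t -> (t%:E < b)%E -> `|q t| < e.

Definition globally_asymptotically_stable (R : realType) (F : vfield R) : Prop :=
  lyapunov_stable F /\
  forall (p : 'rV[R]_2) (a b : \bar R) (q : R -> 'rV[R]_2),
    maximal_integral_curve F p a b q ->
    b = +oo%E /\ q t @[t --> +oo] --> (0 : 'rV[R]_2).

Definition collision_set (R : realType) (X Y : vfield R) : set 'rV[R]_2 :=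
  [set p | \det (col_mx (X p) (Y p) : 'M[R]_2) = 0].

Definition collision_component (R : realType) (X Y : vfield R)
    (G : set 'rV[R]_2) : Prop :=
  exists2 p, (collision_set X Y `\ 0) p &
    G = connected_component (collision_set X Y `\ 0) p.

Definition opposite_direction (R : realType) (v w : 'rV[R]_2) : Prop :=
  v != 0 /\ exists2 c : R, c < 0 & w = c *: v.

Definition inverse_component (R : realType) (X Y : vfield R)
    (G : set 'rV[R]_2) : Prop :=
  collision_component X Y G /\
  forall p, G p -> opposite_direction (X p) (Y p).

(* Only the values of [u] on [0, +oo[ matter. The library's sigma-algebra on [R]
   is the Borel one; a Lebesgue measurable [u] agrees almost everywhere with a
   Borel measurable one, and both have the same solutions. *)
Definition switching_function (R : realType) (u : R -> R) : Prop :=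
  measurable_fun (`[0, +oo[ : set R) u /\ forall t : R, 0 <= t -> 0 <= u t <= 1.

Definition abs_continuous (R : realType) (q : R -> 'rV[R]_2) (s t : R) : Prop :=
  forall e : R, 0 < e -> exists2 d : R, 0 < d &
    forall (n : nat) (a b : 'I_n -> R),
      (forall i, [/\ s <= a i, a i <= b i & b i <= t]) ->
      trivIset setT (fun i => `]a i, b i[%classic) ->
      \sum_(i < n) (b i - a i) < d ->
      \sum_(i < n) `|q (b i) - q (a i)| < e.

(* Solutions in the sense of Caratheodory, on the set of times [0, T[: locally
   absolutely continuous curves that satisfy the equation almost everywhere. *)
Definition switched_solution (R : realType) (X Y : vfield R) (u : R -> R)
    (p : 'rV[R]_2) (T : \bar R) (q : R -> 'rV[R]_2) : Prop :=
  [/\ (0%:E < T)%E, q 0 = p,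
      forall b : R, 0 <= b -> (b%:E < T)%E -> abs_continuous q 0 b &
      {ae (@lebesgue_measure R), forall t : R, 0 < t -> (t%:E < T)%E ->
         is_derive t 1 q (u t *: X (q t) + (1 - u t) *: Y (q t))}].

Definition maximal_switched_solution (R : realType) (X Y : vfield R)
    (u : R -> R) (p : 'rV[R]_2) (T : \bar R) (q : R -> 'rV[R]_2) : Prop :=
  switched_solution X Y u p T q /\
  forall (T' : \bar R) (q' : R -> 'rV[R]_2),
    switched_solution X Y u p T' q' -> (T <= T')%E ->
    (forall t : R, 0 <= t -> (t%:E < T)%E -> q' t = q t) ->
    T' = T.

(* For smooth fields the maximal solution exists and is unique up to its values
   outside [0, T[, so that quantifying over all of them amounts to speaking of
   the maximal solution. *)
Definition globally_attractive (R : realType) (X Y : vfield R) : Prop :=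
  forall (u : R -> R) (p : 'rV[R]_2) (T : \bar R) (q : R -> 'rV[R]_2),
    switching_function u -> maximal_switched_solution X Y u p T q ->
    T = +oo%E /\ q t @[t --> +oo] --> (0 : 'rV[R]_2).

(* Main.v *)
Require Import Defs.
From mathcomp Require Import all_boot all_order all_algebra.
From mathcomp Require Import all_classical all_reals all_analysis.
From mathcomp Require Import ring lra.
Import Order.TTheory GRing.Theory Num.Theory.
Import numFieldNormedType.Exports.
Local Open Scope classical_set_scope.
Local Open Scope ring_scope.

(** The segment joining two nonzero vectors of opposite direction passes through
    the origin.  Hence at a point [p] of an inverse component some convex
    combination of the two fields vanishes, and for the corresponding constant
    switching function the constant curve at [p] is a solution defined for all
    times.  Being defined for all times it is maximal, and it does not converge
    to the origin because components avoid the origin. *)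

Lemma opposite_direction_convex0 (R : realType) (v w : 'rV[R]_2) :
  opposite_direction v w ->
  exists2 l : R, 0 <= l <= 1 & l *: v + (1 - l) *: w = 0.
Proof.
move=> [_ [c c0 ->]].
have d0 : 0 < 1 - c by lra.
(* The root of [l + (1 - l) * c = 0]. *)
exists (- c / (1 - c)).
  by apply/andP; split; [apply: divr_ge0 | rewrite ler_pdivrMr //]; lra.
rewrite scalerA -scalerDl (_ : _ + _ = 0) ?scale0r //.
by field; rewrite gt_eqF.
Qed.

Lemma abs_continuous_cst (R : realType) (p : 'rV[R]_2) (s t : R) :
  abs_continuous (fun=> p) s t.
Proof.
move=> e e0; exists 1 => // n a b _ _ _.
by rewrite big1 // => i _; rewrite subrr normr0.
Qed.

Lemma maximal_switched_solution_cst (R : realType) (X Y : vfield R) (l : R)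
    (p : 'rV[R]_2) :
  l *: X p + (1 - l) *: Y p = 0 ->
  maximal_switched_solution X Y (fun=> l) p +oo (fun=> p).
Proof.
move=> equil; split; last by move=> T' q' _; rewrite leye_eq => /eqP.
split=> //; first exact: ltry.
  by move=> b _ _; exact: abs_continuous_cst.
by apply: aeW => t _ _; rewrite equil; exact: is_derive_cst.
Qed.

Theorem proposition10 (R : realType) (X Y : vfield R)
    (smoothX : smooth X) (smoothY : smooth Y)
    (X0 : X 0 = 0) (Y0 : Y 0 = 0)
    (gasX : globally_asymptotically_stable X)
    (gasY : globally_asymptotically_stable Y)
    (inverseZ : exists G, inverse_component X Y G) :
  ~ globally_attractive X Y.
Proof.
move=> attr; have [G [[p Zp defG] opp]] := inverseZ.
have Gp : G p by rewrite defG; exact: connected_component_refl.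
have p0 : p <> 0 by case: Zp.
have [l l01 equil] := opposite_direction_convex0 _ _ _ (opp p Gp).
have swl : switching_function (fun=> l : R) by split=> //; exact: measurable_cst.
have [_ cvgp] := attr _ _ _ _ swl (maximal_switched_solution_cst _ _ _ _ _ equil).
apply: p0; apply: (cvg_unique _ (cvg_cst p) cvgp).
exact: norm_hausdorff.
Qed.
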